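(* Let $q\geqslant2$ be an even integer, $n\geqslant1$, $L\in\mathcal{O}_n$, $c\in\mathbb{F}_2^n$ of even Hamming weight, and $d\in\mathbb{Z}_q$. For $f:\mathbb{F}_2^n\to\mathbb{Z}_q$ define $g:\mathbb{F}_2^n\to\mathbb{Z}_q$ by $g(x)=f(L(x\oplus c))+\frac q2\langle c,x\rangle+d$. If $f$ is a self-dual generalized bent function then so is $g$, and if $f$ is an anti-self-dual generalized bent function then so is $g$.
   Context: $\mathcal{O}_n=\{L\in\mathrm{GL}(n,\mathbb{F}_2):LL^T=I_n\}$. $\langle x,y\rangle=\bigoplus_ix_iy_i\in\{0,1\}$. With $\omega=e^{2\pi i/q}$, $H_f(y)=\sum_x\omega^{f(x)}(-1)^{\langle x,y\rangle}$; $f$ is self-dual generalized bent if $H_f(y)=2^{n/2}\omega^{f(y)}$ for all $y$, and anti-self-dual generalized bent if $H_f(y)=2^{n/2}\omega^{f(y)+q/2}$ for all $y$. *)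

(* Defs.v *)
From HB Require Import structures.
From mathcomp Require Import all_boot all_order all_algebra.
From mathcomp Require Import complex.
From mathcomp Require Import reals exp trigo.
Set Implicit Arguments.
Unset Strict Implicit.
Unset Printing Implicit Defensive.
Import Order.TTheory GRing.Theory Num.Theory.
Local Open Scope ring_scope.

(* F_2^n is 'cV['F_2]_n, so that a matrix L acts as x |-> L *m x, and the
   complex numbers are R[i] for an arbitrary R : realType.
   Pitfall: 'Z_q is the ring of integers mod q only for 1 < q. *)

Definition orthogonal_group (n : nat) : {set 'M['F_2]_n} :=
  [set L | (L \in unitmx) && (L *m L^T == 1%:M)].

Definition hamming_weight (n : nat) (c : 'cV['F_2]_n) : nat :=
  #|[set i | c i 0 != 0]|.

(* The sum is computed in 'F_2; its value is then read as the natural number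
   0 or 1. *)
Definition dotF2 (n : nat) (x y : 'cV['F_2]_n) : nat :=
  nat_of_ord (\sum_i x i 0 * y i 0).

(* omega = e^(2 i pi / q) *)
Definition omega (R : realType) (q : nat) : R[i] :=
  let t : R := 2 * pi / q%:R in (cos t +i* sin t)%C.

(* omega^a for a residue a, by means of its representative in {0, ..., q-1}. *)
Definition omega_exp (R : realType) (q : nat) (a : 'Z_q) : R[i] :=
  omega R q ^+ nat_of_ord a.

Definition gen_walsh (R : realType) (q n : nat) (f : 'cV['F_2]_n -> 'Z_q)
    (y : 'cV['F_2]_n) : R[i] :=
  \sum_(x : 'cV['F_2]_n) omega_exp R (f x) * (-1) ^+ dotF2 x y.

Definition self_dual_gbent (R : realType) (q n : nat)
    (f : 'cV['F_2]_n -> 'Z_q) : Prop :=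
  forall y : 'cV['F_2]_n,
    gen_walsh R f y = (2 `^ (n%:R / 2))%:C%C * omega_exp R (f y).

Definition anti_self_dual_gbent (R : realType) (q n : nat)
    (f : 'cV['F_2]_n -> 'Z_q) : Prop :=
  forall y : 'cV['F_2]_n,
    gen_walsh R f y =
    (2 `^ (n%:R / 2))%:C%C * omega_exp R (f y + (q %/ 2)%:R).

(* Main.v *)
(* Substituting x = L^T u + c and using that L is orthogonal,
   <c,x> + <x,y> = <x, y + c> = <u, L(y + c)> + <c,y> + <c,c>, where
   <c,c> = wt(c) mod 2 = 0.  Since omega^(q/2) = -1, this gives
   H_g(y) = omega^d (-1)^<c,y> H_f(L(y + c)), and the factor
   omega^d (-1)^<c,y> is also what turns omega^(f(L(y + c))) into
   omega^(g(y)). *)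
Require Import Defs.
From mathcomp Require Import all_boot all_order all_algebra.
From mathcomp Require Import complex reals.
From mathcomp Require Import trigo.
Import GRing.Theory.
Local Open Scope ring_scope.

Lemma cos_sin_expr (R : realType) (t : R) (m : nat) :
  ((cos t +i* sin t) ^+ m = cos (t *+ m) +i* sin (t *+ m))%C.
Proof.
elim: m => [|m IHm]; first by rewrite expr0 mulr0n cos0 sin0.
rewrite exprS IHm mulrS cosD sinD.
by apply/eqP; rewrite eq_complex /= eqxx addrC eqxx.
Qed.

(** By de Moivre the angle [2 * pi / q] is multiplied by [q %/ 2]; since [q] is even this division
    is exact and the angle becomes [pi]. *)
Lemma omega_half (R : realType) (q : nat) :
  (2 <= q)%N -> ~~ odd q -> omega R q ^+ (q %/ 2) = -1.
Proof.
move=> q2 qe.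
have q0 : (q%:R : R) != 0 by rewrite Num.Theory.pnatr_eq0 -lt0n ltnW.
rewrite /omega cos_sin_expr.
have -> : (2 * pi / q%:R) *+ (q %/ 2) = pi :> R.
  have qE : q = (q %/ 2 * 2)%N by rewrite divnK // dvdn2.
  rewrite -mulr_natr [2 * pi]mulrC mulrAC -[_ * 2 * _]mulrA -natrM mulnC -qE.
  by rewrite mulfK.
by rewrite cospi sinpi; apply/eqP; rewrite eq_complex /= oppr0 !eqxx.
Qed.

(** Addition in ['Z_q] reduces the representative mod [q], which is harmless because
    $\omega^q=(\omega^{q/2})^2=1$. *)
Lemma omega_expD (R : realType) (q : nat) (a b : 'Z_q) :
  (2 <= q)%N -> ~~ odd q -> omega_exp R (a + b) = omega_exp R a * omega_exp R b.
Proof.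
move=> q2 qe.
have omega1 : omega R q ^+ q = 1.
  rewrite -[X in _ ^+ X](@divnK 2) ?dvdn2 // exprM omega_half //.
  by rewrite sqrrN expr1n.
rewrite /omega_exp /= -exprD.
by rewrite [X in (_ %% X)%N]Zp_cast // expr_mod.
Qed.

(** Turns the term $\frac q2\langle c,x\rangle$ of [g] into a sign. *)
Lemma omega_exp_half (R : realType) (q m : nat) :
  (2 <= q)%N -> ~~ odd q ->
  omega_exp R ((q %/ 2)%:R * m%:R : 'Z_q) = (-1) ^+ m.
Proof.
move=> q2 qe; elim: m => [|m IHm]; first by rewrite mulr0.
rewrite -natr1 mulrDr mulr1 omega_expD // IHm exprSr; congr (_ * _).
(* As $q/2<q$, the representative of the residue [(q %/ 2)%:R] is [q %/ 2] itself. *)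
rewrite /omega_exp val_Zp_nat // modn_small ?omega_half //.
by rewrite ltn_Pdiv // ltnW.
Qed.

(** A sign depends only on the parity of its exponent, and addition in ['F_2] preserves the parity
    of the sum of representatives. *)
Lemma signF2D (S : pzRingType) (a b : 'F_2) :
  (-1) ^+ nat_of_ord (a + b) = (-1) ^+ nat_of_ord a * (-1) ^+ nat_of_ord b :> S.
Proof.
by rewrite -exprD -signr_odd -[RHS]signr_odd /= modn2 oddb.
Qed.

Lemma dotF2E (n : nat) (x y : 'cV['F_2]_n) :
  dotF2 x y = (x^T *m y) 0 0 :> nat.
Proof.
by rewrite /dotF2 mxE; congr nat_of_ord; apply: eq_bigr => i _; rewrite mxE.
Qed.

Lemma dotF2C (n : nat) (x y : 'cV['F_2]_n) : dotF2 x y = dotF2 y x.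
Proof.
by rewrite /dotF2; congr nat_of_ord; apply: eq_bigr => i _; rewrite mulrC.
Qed.

Lemma sign_dotF2D (S : pzRingType) (n : nat) (x y z : 'cV['F_2]_n) :
  (-1) ^+ dotF2 (x + y) z = (-1) ^+ dotF2 x z * (-1) ^+ dotF2 y z :> S.
Proof. by rewrite !dotF2E linearD mulmxDl mxE signF2D. Qed.

(** Every element of ['F_2] equals its square, so the sum counts the support of [c] mod 2. *)
Lemma dotF2_even (n : nat) (c : 'cV['F_2]_n) :
  ~~ odd (hamming_weight c) -> dotF2 c c = 0%N.
Proof.
move=> ce; rewrite /dotF2.
have -> : \sum_i c i 0 * c i 0 = (hamming_weight c)%:R :> 'F_2.
  rewrite /hamming_weight -sum1_card natr_sum [RHS]big_mkcond.
  apply: eq_bigr => i _; rewrite inE.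
  by case: (c i 0) => [[|[|//]] lti] /=; apply: val_inj.
by rewrite (val_Zp_nat (p := 2)) // modn2 (negbTE ce).
Qed.

Section Transform.
Variables (R : realType) (q n : nat) (L : 'M['F_2]_n).
Variables (c : 'cV['F_2]_n) (d : 'Z_q) (f g : 'cV['F_2]_n -> 'Z_q).
Hypotheses (q2 : (2 <= q)%N) (qe : ~~ odd q) (LO : L \in orthogonal_group n).
Hypothesis ce : ~~ odd (hamming_weight c).
Hypothesis gE : forall x,
  g x = f (L *m (x + c)) + (q %/ 2)%:R * (dotF2 c x)%:R + d.

Let addcc (x : 'cV['F_2]_n) : x + x = 0.
Proof. by apply/colP => i; rewrite !mxE addrr_pchar2 // pchar_Fp. Qed.

Lemma gen_walsh_transform y :
  gen_walsh R g y =
  omega_exp R d * (-1) ^+ dotF2 c y * gen_walsh R f (L *m (y + c)).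
Proof.
have /eqP LLT : L *m L^T == 1%:M by move: LO; rewrite inE => /andP[].
have LTL := mulmx1C LLT.
(* [h] inverts $x\mapsto L(x+c)$, because $L^T$ is a two-sided inverse of $L$ and $c+c=0$. *)
pose h u := L^T *m u + c.
have hK : cancel h (fun x => L *m (x + c)).
  by move=> u; rewrite /h -addrA addcc addr0 mulmxA LLT mul1mx.
have Kh : cancel (fun x => L *m (x + c)) h.
  by move=> x; rewrite /h mulmxA LTL mul1mx -addrA addcc addr0.
rewrite /gen_walsh mulr_sumr (reindex h) /=; last first.
  by exists (fun x => L *m (x + c)) => x _; [apply: hK | apply: Kh].
apply: eq_bigr => u _; rewrite gE hK !omega_expD // omega_exp_half //.
have signE : (-1) ^+ dotF2 c (h u) * (-1) ^+ dotF2 (h u) y =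
    (-1) ^+ dotF2 c y * (-1) ^+ dotF2 u (L *m (y + c)) :> R[i].
  rewrite [dotF2 (h u) y]dotF2C -sign_dotF2D dotF2C /h sign_dotF2D mulrC.
  rewrite [dotF2 c _]dotF2C sign_dotF2D dotF2_even // expr0 mul1r dotF2C.
  (* What remains is the adjunction $\langle L^Tu,v\rangle=\langle u,Lv\rangle$ at $v=y+c$. *)
  by rewrite !dotF2E trmx_mul trmxK mulmxA [c + y]addrC.
rewrite mulrAC -[_ * _ * (-1) ^+ dotF2 (h u) y]mulrA signE mulrC.
by rewrite [omega_exp R (f u) * (_ * _)]mulrCA !mulrA.
Qed.

(** The shift [e] treats both dualities at once: $e=0$ is the self-dual case and $e=q/2$ the
    anti-self-dual one, with $K=2^{n/2}$ in both. *)
Lemma gbent_transform (K : R[i]) (e : 'Z_q) :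
  (forall y, gen_walsh R f y = K * omega_exp R (f y + e)) ->
  forall y, gen_walsh R g y = K * omega_exp R (g y + e).
Proof.
move=> fE y; rewrite gen_walsh_transform fE gE !omega_expD // omega_exp_half //.
rewrite mulrCA; congr (_ * _); rewrite [_ * omega_exp R d]mulrC !mulrA.
by rewrite [_ * _ * omega_exp R (f _)]mulrAC.
Qed.

End Transform.

Theorem theorem7 (R : realType) (q n : nat) (hq2 : (2 <= q)%N)
    (hq : ~~ odd q) (hn : (1 <= n)%N)
    (L : 'M['F_2]_n) (hL : L \in orthogonal_group n)
    (c : 'cV['F_2]_n) (hc : ~~ odd (hamming_weight c)) (d : 'Z_q)
    (f g : 'cV['F_2]_n -> 'Z_q)
    (hg : forall x : 'cV['F_2]_n,
        g x = f (L *m (x + c)) + (q %/ 2)%:R * (dotF2 c x)%:R + d) :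
  (self_dual_gbent R f -> self_dual_gbent R g) /\
  (anti_self_dual_gbent R f -> anti_self_dual_gbent R g).
Proof.
have transfer := gbent_transform R q n L c d f g hq2 hq hL hc hg.
split=> [fE y|]; last exact: transfer.
by rewrite -[g y]addr0; apply: transfer => z; rewrite addr0.
Qed.
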